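(* Let $0<q<1$. The invariant recursive tree process $(X_i)_{i\ge0}$ with marginal $\mathrm{Bernoulli}(\tfrac12)$ associated with the recursive distributional equation $X\overset{d}{=}\xi+X_1 \pmod 2$ on $S=\{0,1\}$, where $\xi\sim\mathrm{Bernoulli}(q)$ and $X_1$ has the same distribution as $X$ and is independent of $\xi$, has trivial tail.
   Context: The unique solution of the stated distributional equation is the $\mathrm{Bernoulli}(\tfrac12)$ distribution. As there is no branching, the invariant recursive tree process with this marginal is indexed by the non-negative integers: it is a process $(X_i)_{i\ge0}$ of $\{0,1\}$-valued random variables, defined jointly with i.i.d. $\mathrm{Bernoulli}(q)$ random variables $(\xi_i)_{i\ge0}$, such that each $X_i\sim\mathrm{Bernoulli}(\tfrac12)$, $X_i=\xi_i+X_{i+1}\pmod 2$ almost surely for all $i\ge0$, and $X_{i+1}$ is independent of $(\xi_0,\dots,\xi_i)$ for all $i\ge0$. The tail $\sigma$-algebra is $\mathcal H=\bigcap_{n\ge0}\sigma(X_i:i\ge n)$; the tail is trivial if every event in $\mathcal H$ has probability $0$ or $1$. *)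

(* Defs.v *)
From mathcomp Require Import all_boot all_order all_algebra finmap.
From mathcomp Require Import all_classical all_reals all_analysis.

Set Implicit Arguments.
Unset Strict Implicit.
Unset Printing Implicit Defensive.

Import Order.TTheory GRing.Theory Num.Theory.

Local Open Scope classical_set_scope.
Local Open Scope ring_scope.

(* The sigma-algebra sigma(Y_i : i in I) on the sample space; it is not
   completed with the P-null sets. *)
Definition sigma_family d d' (T : measurableType d) (S : measurableType d')
    (Y : nat -> T -> S) (I : set nat) : set_system T :=
  <<s \bigcup_(i in I) preimage_set_system setT (Y i) measurable >>.

Definition independent_systems d (T : measurableType d) (R : realType)
    (P : probability T R) (F G : set_system T) : Prop :=
  forall A B, F A -> G B -> P (A `&` B) = (P A * P B)%E.

Definition mutually_independent d d' (T : measurableType d)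
    (S : measurableType d') (R : realType) (P : probability T R)
    (Y : nat -> T -> S) : Prop :=
  forall (J : {fset nat}) (B : nat -> set S), (forall i, measurable (B i)) ->
    P (\bigcap_(i in [set` J]) (Y i @^-1` B i)) =
    (\prod_(i <- J) P (Y i @^-1` B i))%E.

Definition tail_sigma_algebra d d' (T : measurableType d)
    (S : measurableType d') (Y : nat -> T -> S) : set_system T :=
  \bigcap_n sigma_family Y [set i | (n <= i)%N].

Definition trivial_tail d d' (T : measurableType d) (S : measurableType d')
    (R : realType) (P : probability T R) (Y : nat -> T -> S) : Prop :=
  forall A, tail_sigma_algebra Y A -> P A = 0%E \/ P A = 1%E.

(* The invariant recursive tree process with marginal Bernoulli(1/2) of the
   recursive distributional equation X =d xi + X_1 (mod 2), xi ~ Bernoulli(q).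
   There is no branching, so the tree is nat.  The state space S = {0, 1} is
   bool (0 = false, 1 = true), on which addition modulo 2 is addb. *)
Record invariant_rtp d (T : measurableType d) (R : realType)
    (P : probability T R) (q : R) (xi X : nat -> {RV P >-> bool}) : Prop := {
  rtp_innovation_law : forall i, distribution P (xi i) =1 bernoulli_prob q ;
  rtp_innovation_indep : mutually_independent P (fun i => xi i : T -> bool) ;
  rtp_marginal : forall i, distribution P (X i) =1 bernoulli_prob (2^-1 : R) ;
  rtp_recursion : forall i,
    {ae P, forall t, X i t = xi i t (+) X i.+1 t} ;
  rtp_indep : forall i, independent_systems P
    (sigma_family (fun j => X j : T -> bool) [set i.+1])
    (sigma_family (fun j => xi j : T -> bool) [set j | (j <= i)%N]) }.

(* Main.v *)
Require Import Defs.
From mathcomp Require Import all_boot all_order all_algebra finmap.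
From mathcomp Require Import all_classical all_reals all_analysis.
From mathcomp Require Import ring lra zify.
Set Implicit Arguments.
Unset Strict Implicit.
Unset Printing Implicit Defensive.
Import Order.TTheory GRing.Theory Num.Theory.
Local Open Scope classical_set_scope.
Local Open Scope ring_scope.

(** Why the tail is trivial.  Unrolling the recursion, the event that
    X_n, ..., X_m follow a word v_n ... v_m is, up to a null set, the event that
    X_m = v_m and xi_i = v_i + v_(i+1) for n <= i < m.  By the independence
    assumptions its probability is half of the product of the Bernoulli weights
    of the v_i + v_(i+1) ([X_cylinder_law]).  So, read from large indices
    to small ones, X is a stationary Markov chain on two points; each backward
    step keeps the state with probability 1 - q and flips it with probability
    q.  Since such cylinders form a pi-system, the Markov property holds against
    every event of sigma(X_i : i >= n) ([X_markov]).

    Let A be a tail event and D_n = P(A, X_n = 1) - P(A, X_n = 0).  As A belongs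
    to sigma(X_i : i >= n) for every n, one Markov step gives
    D_n = (1 - 2q) D_(n+1), hence |D_n| <= |1 - 2q|^k for all k, and D_n = 0
    because |1 - 2q| < 1 ([tail_uniform]).  Thus every X_n is independent of
    A, and the Markov property makes A independent of every cylinder of
    X_0, ..., X_n.  These generate a sigma-algebra that contains A, so
    A is independent of itself ([tail_self_independent]) and P(A) is 0 or 1. *)

(** * Cylinders of a process with values in bool *)

Section cylinders.
Context {T : Type} (Y : nat -> T -> bool).

(** The window of indices is half-open, so that the whole space is a cylinder and
    consecutive windows concatenate. *)
Definition cylinder (n m : nat) (v : nat -> bool) : set T :=
  [set t | forall i, (n <= i < m)%N -> Y i t = v i].

(** The empty set is added because two cylinders with incompatible words are
    disjoint; with it, the family is a pi-system. *)
Definition cylinders (n : nat) : set_system T :=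
  [set C | C = set0 \/ exists m v, C = cylinder n m v].

Lemma cylinder_geq n m v : (m <= n)%N -> cylinder n m v = setT.
Proof. by move=> mn; apply/seteqP; split=> // t _ i; lia. Qed.

Lemma cylinder1 n v : cylinder n n.+1 v = Y n @^-1` [set v n].
Proof.
apply/seteqP; split=> t /=; first by apply; rewrite leqnn ltnSn.
by move=> h i; rewrite ltnS -eqn_leq => /eqP <-.
Qed.

Lemma cylinderSr n m v : (n <= m)%N ->
  cylinder n m.+1 v = cylinder n m v `&` Y m @^-1` [set v m].
Proof.
move=> nm; apply/seteqP; split=> [t h|t [h hm] i].
  by split=> [i i_nm|]; apply: h; lia.
by move=> i_nm; have [->//|i_m] := eqVneq i m; apply: h; lia.
Qed.

Lemma cylinderSl n m v : (n <= m)%N ->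
  cylinder n m.+1 v = Y n @^-1` [set v n] `&` cylinder n.+1 m.+1 v.
Proof.
move=> nm; apply/seteqP; split=> [t h|t [hn h] i].
  by split=> [|i i_nm]; apply: h; lia.
by move=> i_nm; have [->//|i_n] := eqVneq i n; apply: h; lia.
Qed.

Lemma eq_cylinder n m v w : (forall i, (n <= i < m)%N -> v i = w i) ->
  cylinder n m v = cylinder n m w.
Proof.
by move=> vw; apply/seteqP; split=> t h i i_nm; rewrite h ?vw.
Qed.

(** Two words starting at the same index either disagree somewhere, or are both
    read off the longer one. *)
Lemma cylinderI n m p v w :
  cylinder n m v `&` cylinder n p w = set0 \/
  exists u, cylinder n m v `&` cylinder n p w = cylinder n (maxn m p) u /\
    (forall i, (n <= i < m)%N -> u i = v i).
Proof.
have [vw|vw] := pselect (forall i, (n <= i < minn m p)%N -> v i = w i).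
  right; exists (fun i => if (i < m)%N then v i else w i); split; last first.
    by move=> i /andP[_ ->].
  apply/seteqP; split=> [t [hv hw] i i_n|t h].
    by case: ifPn => i_m; [apply: hv|apply: hw]; lia.
  split=> i i_n; rewrite h; try lia; last by case: ifPn => // i_m; apply: vw; lia.
  by rewrite ifT//; lia.
left; apply/seteqP; split=> // t [hv hw]; apply: vw => i i_n.
by rewrite -hv ?hw//; lia.
Qed.

Lemma setI_closed_cylinders n : setI_closed (cylinders n).
Proof.
move=> A B [->|[m [v ->]]]; first by rewrite set0I; left.
move=> [->|[p [w ->]]]; first by rewrite setI0; left.
have [->|[u [-> _]]] := cylinderI n m p v w; first by left.
by right; exists (maxn m p), u.
Qed.

Lemma cylinder_cat n m p v w : (n <= m <= p)%N ->
  cylinder n m v `&` cylinder m p w =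
  cylinder n p (fun i => if (i < m)%N then v i else w i).
Proof.
move=> nmp; apply/seteqP; split=> [t [hv hw] i i_n|t h].
  by case: ifPn => i_m; [apply: hv|apply: hw]; lia.
split=> i i_n; rewrite h; try lia; first by rewrite ifT//; lia.
by rewrite ifF//; lia.
Qed.

End cylinders.

Lemma measurable_cylinder d (T : measurableType d) (Y : nat -> T -> bool) n m v :
  (forall i, (n <= i < m)%N -> measurable (Y i @^-1` [set v i])) ->
  measurable (cylinder Y n m v).
Proof.
elim: m => [|m IH] mY; first by rewrite cylinder_geq.
have [nm|nm] := leqP n m; last by rewrite cylinder_geq.
rewrite cylinderSr//; apply: measurableI; last by apply: mY; lia.
by apply: IH => i i_nm; apply: mY; lia.
Qed.

Lemma sigma_family_cylinder d (T : measurableType d) (Y : nat -> T -> bool)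
    I n m v :
  (forall i, (n <= i < m)%N -> I i) -> sigma_family Y I (cylinder Y n m v).
Proof.
move=> nmI; apply: (@measurable_cylinder _ (g_sigma_algebraType
  (\bigcup_(i in I) preimage_set_system setT (Y i) measurable))) => i /nmI Ii.
apply: sub_gen_smallest; exists i => //; exists [set v i] => //.
by rewrite setTI.
Qed.

(** An event on a single Y_i is a finite union of cylinders that start at n: the
    values at n, ..., i - 1 are freed one at a time. *)
Lemma sub_sigma_family_cylinders d (T : measurableType d)
    (Y : nat -> T -> bool) n :
  sigma_family Y [set i | (n <= i)%N] `<=` <<s cylinders Y n >>.
Proof.
apply: smallest_sub; first exact: smallest_sigma_algebra.
move=> _ [i /= ni [B _ <-]]; rewrite setTI.
pose S : measurableType _ := g_sigma_algebraType (cylinders Y n).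
have Scyl j v : (n <= j <= i)%N -> measurable (cylinder Y j i.+1 v : set S).
  move=> /andP[nj]; rewrite -(subnKC nj).
  elim: (j - n)%N v => [|k IH] v ki.
    by rewrite addn0; apply: sub_gen_smallest; right; exists i.+1, v.
  (* The two words that agree with v except for the value b at the index n + k. *)
  pose w b l := if l == (n + k)%N then b else v l.
  have -> : cylinder Y (n + k.+1) i.+1 v =
      cylinder Y (n + k) i.+1 (w true) `|` cylinder Y (n + k) i.+1 (w false).
    have w_ext b : cylinder Y (n + k) i.+1 (w b) =
        Y (n + k)%N @^-1` [set b] `&` cylinder Y (n + k.+1) i.+1 v.
      rewrite cylinderSl; last by lia.
      rewrite /w eqxx addnS; congr (_ `&` _).
      by apply: eq_cylinder => l nkl; rewrite ifF//; lia.
    rewrite !w_ext -setIUl; apply/seteqP; split=> [t h|t []//]; split=> //=.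
    by case: (Y _ t); [left|right].
  by apply: measurableU; apply: IH; lia.
have S1 b : measurable (Y i @^-1` [set b] : set S).
  by have := Scyl i (fun=> b); rewrite ni leqnn cylinder1; apply.
have := @subsetT _ B; rewrite setT_bool => BT.
change (measurable (Y i @^-1` B : set S)).
have [->|->|->|->] := subset_set2 BT.
- by rewrite preimage_set0.
- exact: S1.
- exact: S1.
- by rewrite preimage_setU; apply: measurableU.
Qed.

Lemma mutually_independent_cylinder d (T : measurableType d) (R : realType)
    (P : probability T R) (Y : nat -> T -> bool) n m v :
  mutually_independent P Y ->
  P (cylinder Y n m v) = (\prod_(n <= i < m) P (Y i @^-1` [set v i]))%E.
Proof.
move=> /(_ [fset i in index_iota n m]%fset (fun i => [set v i])) indep.
transitivity (P (\bigcap_(i in [set` [fset i in index_iota n m]%fset])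
    Y i @^-1` [set v i])).
  congr (P _); apply/seteqP; split=> t h i; last first.
    by move=> i_nm; apply: h => /=; rewrite !inE mem_index_iota.
  by rewrite /= !inE mem_index_iota; apply: h.
rewrite indep//; apply: perm_big.
apply: uniq_perm; rewrite ?fset_uniq ?iota_uniq//.
by move=> i; rewrite !inE.
Qed.

(** Both uses of the pi-lambda theorem, the Markov property and the final
    self-independence, are instances of this uniqueness statement. *)
Lemma eq_measure_cylinders d (T : measurableType d) (R : realType)
    (Y : nat -> T -> bool) n (mu nu : {measure set T -> \bar R}) :
  (forall i b, measurable (Y i @^-1` [set b])) -> (mu setT < +oo)%E ->
  (forall m v, mu (cylinder Y n m v) = nu (cylinder Y n m v)) ->
  forall A, sigma_family Y [set i | (n <= i)%N] A -> mu A = nu A.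
Proof.
move=> mY fin_mu eq_mn A SA.
apply: (@g_sigma_algebra_measure_unique _ R T (cylinders Y n) _ (fun=> setT)).
- by move=> _ [->|[m [v ->]]]//; exact: measurable_cylinder.
- by move=> _; right; exists n, xpredT; rewrite cylinder_geq.
- by rewrite bigcup_const//; exists 0%N.
- exact: setI_closed_cylinders.
- by move=> _ [->|[m [v ->]]]; rewrite ?measure0.
- by [].
- exact: sub_sigma_family_cylinders.
Qed.

(** * The process as a reversed two-state Markov chain *)

Lemma ae_iff_measure d (T : measurableType d) (R : realType)
    (mu : {measure set T -> \bar R}) (A B : set T) :
  measurable A -> measurable B -> {ae mu, forall t, A t <-> B t} ->
  mu A = mu B.
Proof.
move=> mA mB [N [mN N0 AB]].
suff le_mu C D : measurable C -> measurable D ->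
    (forall t, ~ N t -> C t -> D t) -> (mu C <= mu D)%E.
  have iffAB t : ~ N t -> (A t <-> B t) by move=> Nt; apply: contrapT => /AB.
  by apply/le_anti/andP; split; apply: le_mu => // t /iffAB[].
move=> mC mD CD; apply: (@le_trans _ _ (mu (D `|` N))).
  rewrite le_measure ?inE//; first exact: measurableU.
  by move=> t Ct; have [Nt|Nt] := pselect (N t); [right|left; exact: CD].
apply: (le_trans (measureU2 _ _ _)) => //.
by rewrite [X in (_ + X)%E]N0 adde0.
Qed.

Lemma measurable_event d (T : measurableType d) (R : realType)
    (P : probability T R) (Y : {RV P >-> bool}) b :
  measurable (Y @^-1` [set b]).
Proof. by rewrite -[X in measurable X]setTI; exact: measurable_funPT. Qed.

Lemma bernoulli_prob1 (R : realType) (p : R) b : 0 <= p <= 1 ->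
  bernoulli_prob p [set b] = (bernoulli_pmf p b)%:E.
Proof. by move=> p01; rewrite /bernoulli_prob p01 fsbig_set1. Qed.

Section markov_chain.
Context d (T : measurableType d) (R : realType) (P : probability T R) (q : R).
Hypothesis q01 : 0 <= q <= 1.
Variables xi X : nat -> {RV P >-> bool}.
Hypothesis hX : invariant_rtp q xi X.

Local Notation Xf := (fun i => X i : T -> bool).
Local Notation xif := (fun i => xi i : T -> bool).
Local Notation Xc := (cylinder Xf).
Local Notation sigmaX n := (sigma_family Xf [set i | (n <= i)%N]).

(** The conditional probability, given X_m = v_m, that the chain then follows the
    word v backwards down to the index n. *)
Definition path_weight (v : nat -> bool) (n m : nat) : R :=
  \prod_(n <= i < m) bernoulli_pmf q (v i (+) v i.+1).

Lemma path_weight_ge0 v n m : 0 <= path_weight v n m.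
Proof.
by apply: prodr_ge0 => i _; apply: bernoulli_pmf_ge0.
Qed.

Lemma measurable_sigmaX n : sigmaX n `<=` measurable.
Proof.
apply: smallest_sub; first exact: sigma_algebra_measurable.
by move=> _ [i _ [B mB <-]]; exact: measurable_funPT.
Qed.

Lemma measurable_X_cylinder n m v : measurable (Xc n m v).
Proof. by apply: measurable_cylinder => i _; exact: measurable_event. Qed.

(** The forward inclusion reads each xi_i off two consecutive values of X; the
    backward one rebuilds X_(m-1), ..., X_n successively from X_m. *)
Lemma recursion_cylinder n m v : (n <= m)%N ->
  P (Xc n m.+1 v) =
  P (X m @^-1` [set v m] `&`
     cylinder xif n m (fun i => v i (+) v i.+1)).
Proof.
move=> nm; apply: ae_iff_measure.
- exact: measurable_X_cylinder.
- apply: measurableI; first exact: measurable_event.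
  by apply: measurable_cylinder => i _; exact: measurable_event.
have := ae_foralln (rtp_recursion hX); apply: filterS => t rec.
rewrite cylinderSr//; split=> [[h hm]|[/= hm h]].
  split=> // i i_nm; have := rec i; rewrite h//.
  have -> : X i.+1 t = v i.+1.
    by have [->//|im] := eqVneq i.+1 m; apply: h; lia.
  by case: (xi i t) (v i) (v i.+1) => -[] [].
split=> // i /andP[ni im].
rewrite -(subKn (ltnW im)).
have: (m - i <= m - n)%N by lia.
(* Induction on the distance to the right end of the window. *)
elim: (m - i)%N => [|k IH] km; first by rewrite subn0.
have -> := rec (m - k.+1)%N; rewrite h; last by lia.
have -> : (m - k.+1).+1 = (m - k)%N by lia.
by rewrite IH ?addbK//; lia.
Qed.

(** After the change of variables, X_m and the innovations of the window are
    mutually independent; the factor 1/2 comes from X_m. *)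
Lemma X_cylinder_law n m v : (n <= m)%N ->
  P (Xc n m.+1 v) = (path_weight v n m * 2^-1)%:E.
Proof.
move=> nm; rewrite recursion_cylinder//.
have half : P (X m @^-1` [set v m]) = (2^-1)%:E.
  rewrite -[LHS]/(distribution P (X m) [set v m]) (rtp_marginal hX).
  rewrite bernoulli_prob1.
    by rewrite /bernoulli_pmf; case: (v m) => //; congr EFin; lra.
  by lra.
have -> : P (X m @^-1` [set v m] `&`
     cylinder xif n m (fun i => v i (+) v i.+1)) =
  (P (X m @^-1` [set v m]) *
   P (cylinder xif n m (fun i => v i (+) v i.+1)))%E.
  (* The hypothesis starts at X_1; for m = 0 the window is empty. *)
  case: m nm half => [|m] nm _.
    by rewrite (@cylinder_geq _ _ n 0)// setIT probability_setT mule1.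
  apply: (rtp_indep hX).
    apply: sub_gen_smallest; exists m.+1 => //.
    by exists [set v m.+1] => //; rewrite setTI.
  by apply: sigma_family_cylinder => i /= /andP[_ im]; lia.
rewrite half mutually_independent_cylinder; last exact: rtp_innovation_indep hX.
rewrite mulrC EFinM; congr (_ * _)%E; rewrite /path_weight -prodEFin.
apply: eq_bigr => i _.
rewrite -[LHS]/(distribution P (xi i) [set v i (+) v i.+1]).
rewrite (rtp_innovation_law hX).
by rewrite bernoulli_prob1.
Qed.

(** Both sides are finite measures in C, so it is enough to take C a cylinder
    starting at n: then the words of C and v concatenate and the weight of the
    concatenation factors at n. *)
Lemma X_markov j n v C : (j <= n)%N -> sigmaX n C ->
  P (C `&` Xc j n.+1 v) =
  ((path_weight v j n)%:E * P (C `&` X n @^-1` [set v n]))%E.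
Proof.
move=> jn SC.
pose mu := mrestr P (measurable_X_cylinder j n.+1 v).
pose nu := mscale (NngNum (path_weight_ge0 v j n))
  (mrestr P (measurable_event (X n) (v n))).
apply: (@eq_measure_cylinders _ _ _ Xf n mu nu _ _ _ C SC).
- by move=> i b; exact: measurable_event.
- rewrite -[X in (X < _)%E]/(P (setT `&` Xc j n.+1 v)) setTI.
  by rewrite -ge0_fin_numE// fin_num_measure//; exact: measurable_X_cylinder.
move=> p w; rewrite -[LHS]/(P (Xc n p w `&` Xc j n.+1 v)).
rewrite -[RHS]/((path_weight v j n)%:E *
             P (Xc n p w `&` X n @^-1` [set v n]))%E.
(* Splitting off X_n = v_n from the word of v, and merging it with C. *)
rewrite cylinderSr// -[X n @^-1` _](cylinder1 Xf).
rewrite setICA (setIC (Xc n p w)).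
have [->|[u [-> uv]]] := cylinderI Xf n n.+1 p v w.
  by rewrite setI0 measure0 mule0.
have [r r_gt ->] : exists2 r, (n <= r)%N & maxn n.+1 p = r.+1.
  by exists (maxn n.+1 p).-1; lia.
rewrite cylinder_cat; last by lia.
rewrite !X_cylinder_law//; last by lia.
rewrite -EFinM mulrA; congr (_ * _)%:E.
rewrite /path_weight (@big_cat_nat _ _ _ n)//=; congr (_ * _).
  apply: eq_big_nat => i /andP[_ i_n]; rewrite i_n.
  case: ifPn => // n_i; rewrite uv; last by lia.
  by rewrite (_ : i.+1 = n)//; lia.
by apply: eq_big_nat => i i_n; rewrite !ifF//; lia.
Qed.

Lemma path_weight1 v n :
  path_weight v n n.+1 = bernoulli_pmf q (v n (+) v n.+1).
Proof. by rewrite /path_weight big_nat1. Qed.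

Lemma X_transition n a C : sigmaX n.+1 C ->
  P (C `&` X n @^-1` [set a]) =
  ((bernoulli_pmf q a)%:E * P (C `&` X n.+1 @^-1` [set false]) +
   (bernoulli_pmf q (~~ a))%:E * P (C `&` X n.+1 @^-1` [set true]))%E.
Proof.
move=> SC.
have mC := measurable_sigmaX SC.
have step b : P (C `&` (X n @^-1` [set a] `&` X n.+1 @^-1` [set b])) =
    ((bernoulli_pmf q (a (+) b))%:E * P (C `&` X n.+1 @^-1` [set b]))%E.
  have := X_markov (fun i => if i == n then a else b) (leqnSn n) SC.
  rewrite cylinderSr// cylinder1 path_weight1 eqxx /=.
  by rewrite (gtn_eqF (ltnSn n)).
rewrite -addbT -[in (bernoulli_pmf q a)%:E](addbF a) -!step -measureU.
- congr (P _); apply/seteqP; split=> [t [Ct Xt]|t [|] [Ct []]//].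
  by case Xt1 : (X n.+1 t); [right|left]; do !split.
- by do 2?apply: measurableI => //; exact: measurable_event.
- by do 2?apply: measurableI => //; exact: measurable_event.
- by rewrite -subset0 => t [[_ [_ /= ->]] [_ []]].
Qed.

(** * Tail events *)

Local Notation tailX := (tail_sigma_algebra Xf).

(** The two-state chain contracts the difference of the masses by 1 - 2q at each
    step, and a tail event allows infinitely many steps.  This is where q = 0 and
    q = 1 must be excluded: there the contraction factor is 1 or -1. *)
Lemma tail_uniform n a A : 0 < q < 1 -> tailX A ->
  P (A `&` X n @^-1` [set a]) = ((2^-1)%:E * P A)%E.
Proof.
move=> /andP[q0 q1] tA.
have mA : measurable A by apply: (@measurable_sigmaX 0); exact: tA.
pose p k b : R := fine (P (A `&` X k @^-1` [set b])).
have mAX k b : measurable (A `&` X k @^-1` [set b]).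
  by apply: measurableI => //; exact: measurable_event.
have pE k b : P (A `&` X k @^-1` [set b]) = (p k b)%:E.
  by rewrite fineK// fin_num_measure.
have p_step k b :
    p k b = bernoulli_pmf q b * p k.+1 false +
            bernoulli_pmf q (~~ b) * p k.+1 true.
  have := X_transition b (tA k.+1 I).
  by rewrite !pE -!EFinM -EFinD => -[].
have p_sum k : P A = (p k true + p k false)%:E.
  rewrite EFinD -!pE -measureU//; last by rewrite -subset0 => t [[_ /= ->] []].
  congr (P _); apply/seteqP; split=> [t At|t [|] []//].
  by case Xt : (X k t); [left|right].
pose D k := p k true - p k false.
have D_iter k : D n = (1 - 2 * q) ^+ k * D (n + k)%N.
  elim: k => [|k ->]; first by rewrite mul1r addn0.
  rewrite addnS exprSr -mulrA; congr (_ * _).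
  by rewrite /D !(p_step (n + k)%N) /bernoulli_pmf /=; ring.
have D_le1 k : `|D k| <= 1.
  have p0 b : 0 <= p k b by exact: fine_ge0.
  have : p k true + p k false <= 1.
    by rewrite -lee_fin -p_sum probability_le1.
  by have := p0 true; have := p0 false; rewrite /D ler_norml; lra.
have D0 : D n = 0.
  apply/eqP; rewrite -normr_le0.
  have r1 : `|1 - 2 * q| < 1 by rewrite ltr_norml; apply/andP; split; lra.
  have r_cvg : (`|1 - 2 * q| ^+ k) @[k --> \oo] --> 0.
    by apply: cvg_expr; rewrite normr_id.
  apply: (cvgr_to_ge r_cvg); apply: nearW => k.
  by rewrite (D_iter k) normrM normrX ler_piMr.
rewrite pE (p_sum n) -EFinM; congr EFin.
by move: D0; rewrite /D; case: a; lra.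
Qed.

Lemma tail_independent_cylinder n v A : 0 < q < 1 -> tailX A ->
  P (Xc 0 n v `&` A) = (P (Xc 0 n v) * P A)%E.
Proof.
move=> hq tA; case: n => [|n].
  by rewrite cylinder_geq// setTI probability_setT mul1e.
rewrite setIC X_markov//; last exact: tA.
by rewrite tail_uniform// X_cylinder_law// muleA.
Qed.

Lemma tail_self_independent A : 0 < q < 1 -> tailX A -> P A = (P A * P A)%E.
Proof.
move=> hq tA.
have mA : measurable A by apply: (@measurable_sigmaX 0); exact: tA.
pose PA := fine (P A).
have PA0 : 0 <= PA by exact: fine_ge0.
have PAE : P A = PA%:E by rewrite fineK// fin_num_measure.
rewrite -[LHS](congr1 P (setIid A)) {2}PAE muleC.
apply: (@eq_measure_cylinders _ _ _ Xf 0
  (mrestr P mA) (mscale (NngNum PA0) P)).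
- by move=> i b; exact: measurable_event.
- rewrite -[X in (X < _)%E]/(P (setT `&` A)) setTI.
  by rewrite -ge0_fin_numE// fin_num_measure.
- move=> m v; rewrite -[LHS]/(P (Xc 0 m v `&` A)) tail_independent_cylinder//.
  by rewrite -[RHS]/(PA%:E * P (Xc 0 m v))%E -PAE muleC.
- exact: tA.
Qed.

End markov_chain.

Theorem proposition2 (d : measure_display) (T : measurableType d)
  (R : realType) (P : probability T R) (q : R) (hq : 0 < q < 1)
  (xi X : nat -> {RV P >-> bool}) (hX : invariant_rtp q xi X) :
  trivial_tail P (fun i => X i : T -> bool).
Proof.
move=> A tA; have mA : measurable A.
  by apply: (@measurable_sigmaX _ _ _ _ X 0); exact: tA.
have q01 : 0 <= q <= 1 by case/andP: hq => q0 q1; rewrite !ltW.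
have := tail_self_independent q01 hX hq tA.
have <- : (fine (P A))%:E = P A by rewrite fineK// fin_num_measure.
rewrite -EFinM => -[PAA].
have /eqP : fine (P A) * (1 - fine (P A)) = 0 by rewrite mulrBr mulr1 -PAA subrr.
by rewrite mulf_eq0 subr_eq0 => /orP[/eqP ->|/eqP <-]; [left|right].
Qed.
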